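(* Let $K$ be a compact abelian group with dual group $\Gamma=\widehat K$ (written additively), let $A$ be a $*$-algebra, and let $\alpha,\beta:K\to\mathrm{Aut}(A)$ be two actions by $*$-automorphisms whose finite spectral cores $A_{\mathrm{fin}}^\alpha$ and $A_{\mathrm{fin}}^\beta$ coincide as vector spaces. Assume that $A_{\mathrm{fin}}^\alpha$ is algebraically the direct sum of its spectral subspaces and that $\alpha$ and $\beta$ are determined by their values on $A_{\mathrm{fin}}^\alpha$ (e.g. $A_{\mathrm{fin}}^\alpha$ is dense in a chosen topology and $\alpha,\beta$ are continuous). Let $\sigma$ be a normalized unitary $2$-cocycle on $\Gamma$. (i) If $A_\gamma^\alpha=A_\gamma^\beta$ for all $\gamma\in\Gamma$, then the cocycle twisted products for $(\alpha,\sigma)$ and $(\beta,\sigma)$ on $A_{\mathrm{fin}}^\alpha=A_{\mathrm{fin}}^\beta$ coincide. (ii) If $\beta=\alpha\circ\psi$ for some $\psi\in\mathrm{Aut}(K)$, then the cocycle twisted product for $(\beta,\sigma)$ agrees with the cocycle twisted product for $(\alpha,\sigma^\psi)$, where $\sigma^\psi(\gamma,\eta):=\sigma\big(\widehat\psi^{-1}(\gamma),\widehat\psi^{-1}(\eta)\big)$ and $\widehat\psi(\gamma):=\gamma\circ\psi^{-1}$. In particular, if $\sigma^\psi=\sigma$, then $(\alpha,\sigma)$ and $(\beta,\sigma)$ define the same product.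
   Context: For an action $\alpha$ of $K$ on $A$ and $\gamma\in\Gamma$, the spectral subspace is $A_\gamma^\alpha:=\{a\in A:\alpha_t(a)=\gamma(t)a\ \forall t\in K\}$ and the finite spectral core is $A_{\mathrm{fin}}^\alpha:=\bigoplus^{\mathrm{alg}}_\gamma A_\gamma^\alpha$. A normalized unitary $2$-cocycle on $\Gamma$ is $\sigma:\Gamma\times\Gamma\to\{z\in\mathbb{C}:|z|=1\}$ with $\sigma(p,0)=\sigma(0,p)=1$ and $\sigma(p,q)\sigma(p+q,r)=\sigma(q,r)\sigma(p,q+r)$. The cocycle twisted product for $(\alpha,\sigma)$ on $A_{\mathrm{fin}}^\alpha$ is $a_\gamma\star_\sigma b_\eta:=\sigma(\gamma,\eta)a_\gamma b_\eta$ for $a_\gamma\in A_\gamma^\alpha$, $b_\eta\in A_\eta^\alpha$, extended bilinearly. $\mathrm{Aut}(K)$ is the group of (topological group) automorphisms of $K$, and $(\alpha\circ\psi)_t=\alpha_{\psi(t)}$. ''Determined by their values on $A_{\mathrm{fin}}^\alpha$'' means: whenever $s,t\in K$ and $\alpha_s$, $\beta_t$ agree on $A_{\mathrm{fin}}^\alpha$, then $\alpha_s=\beta_t$ on $A$. *)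

(* Defs.v *)
From HB Require Import structures.
From mathcomp Require Import all_boot all_order all_algebra.
From mathcomp Require Import all_classical all_reals all_analysis.
From mathcomp Require Import finmap.
From mathcomp.real_closed Require Import complex.

Set Implicit Arguments.
Unset Strict Implicit.
Unset Printing Implicit Defensive.

Import Order.TTheory GRing.Theory Num.Theory.
Import numFieldNormedType.Exports.

Local Open Scope classical_set_scope.
Local Open Scope ring_scope.

(* R[i] is the field of complex numbers over R; its usual topology is the one
   carried by the regular module R[i]^o. *)

(* Complex *-algebras, not necessarily unital. *)
HB.mixin Record Lmodule_isStarAlgebra (R : realType) A
    of GRing.Lmodule R[i] A := {
  amul : A -> A -> A;
  star : A -> A;
  amulA : associative amul;
  amulDl : left_distributive amul +%R;
  amulDr : right_distributive amul +%R;
  amulZl : forall (z : R[i]) a b, amul (z *: a) b = z *: amul a b;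
  amulZr : forall (z : R[i]) a b, amul a (z *: b) = z *: amul a b;
  starK : involutive star;
  starD : {morph star : a b / a + b};
  starZ : forall (z : R[i]) a, star (z *: a) = Num.conj z *: star a;
  starM : forall a b, star (amul a b) = amul (star b) (star a)
}.

#[short(type="starAlgType")]
HB.structure Definition StarAlgebra (R : realType) :=
  {A of GRing.Lmodule R[i] A & Lmodule_isStarAlgebra R A}.

(* The Pontryagin dual of a topological abelian group K, K being written
   additively. *)
Record dual (R : realType) (K : topologicalZmodType) := Dual {
  dual_fun :> K -> R[i];
  dual_norm1 : forall t, `|dual_fun t| = 1;
  dualD : forall s t, dual_fun (s + t) = dual_fun s * dual_fun t;
  dual_continuous : continuous (dual_fun : K -> R[i]^o)
}.

Section DualGroup.
Variables (R : realType) (K : topologicalZmodType).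
Implicit Types g h k : dual R K.

HB.instance Definition _ := gen_eqMixin (dual R K).
HB.instance Definition _ := gen_choiceMixin (dual R K).

Lemma dual_eqP g h : g =1 h -> g = h.
Proof.
case: g h => [f f1 fD fc] [f' f1' fD' fc'] /= /funext ff'.
rewrite {}ff' in f1 fD fc *; congr Dual; exact: Prop_irrelevance.
Qed.

Lemma dual_neq0 g t : g t != 0.
Proof. by rewrite -normr_eq0 dual_norm1 oner_eq0. Qed.

Definition dual_zero : dual R K.
Proof.
by exists (fun=> 1) => [t|s t|]; rewrite ?normr1 ?mulr1//; exact: cst_continuous.
Defined.

Definition dual_add g h : dual R K.
Proof.
exists (fun t => g t * h t) => [t|s t|t].
- by rewrite normrM !dual_norm1 mulr1.
- by rewrite !dualD mulrACA.
- by apply: (@cvgM R[i]); exact: dual_continuous.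
Defined.

Definition dual_opp g : dual R K.
Proof.
exists (fun t => (g t)^-1) => [t|s t|t].
- by rewrite normfV dual_norm1 invr1.
- by rewrite dualD invfM.
- by apply: (@cvgV R[i]); [exact: dual_neq0|exact: dual_continuous].
Defined.

Lemma dual_addA : associative dual_add.
Proof. by move=> g h k; apply: dual_eqP => t /=; rewrite mulrA. Qed.

Lemma dual_addC : commutative dual_add.
Proof. by move=> g h; apply: dual_eqP => t /=; rewrite mulrC. Qed.

Lemma dual_add0 : left_id dual_zero dual_add.
Proof. by move=> g; apply: dual_eqP => t /=; rewrite mul1r. Qed.

Lemma dual_addN : left_inverse dual_zero dual_opp dual_add.
Proof. by move=> g; apply: dual_eqP => t /=; rewrite mulVf// dual_neq0. Qed.

HB.instance Definition _ :=
  GRing.isZmodule.Build (dual R K) dual_addA dual_addC dual_add0 dual_addN.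

End DualGroup.

(* Aut(K): automorphisms of the topological group K. *)
Record topAut (K : topologicalZmodType) := TopAut {
  topAut_fun :> K -> K;
  topAut_inv : K -> K;
  topAutD : {morph topAut_fun : s t / s + t};
  topAutK : cancel topAut_fun topAut_inv;
  topAutVK : cancel topAut_inv topAut_fun;
  topAut_continuous : continuous topAut_fun;
  topAut_inv_continuous : continuous topAut_inv
}.

Lemma topAut_invD (K : topologicalZmodType) (psi : topAut K) :
  {morph topAut_inv psi : s t / s + t}.
Proof.
move=> s t; apply: (can_inj (@topAutK K psi)).
by rewrite topAutD !topAutVK.
Qed.

Definition topAutV (K : topologicalZmodType) (psi : topAut K) : topAut K :=
  TopAut (@topAut_invD K psi) (@topAutVK K psi) (@topAutK K psi)
    (@topAut_inv_continuous K psi) (@topAut_continuous K psi).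

Definition dual_comp (R : realType) (K : topologicalZmodType)
  (g : dual R K) (psi : topAut K) : dual R K.
Proof.
exists (g \o psi) => [t|s t|t].
- exact: dual_norm1.
- by rewrite /= topAutD dualD.
- apply: (@continuous_comp K K R[i]^o); first exact: topAut_continuous.
  exact: dual_continuous.
Defined.

(* hat psi : g |-> g \o psi^-1, and its inverse hat psi ^-1 : g |-> g \o psi. *)
Definition hat (R : realType) (K : topologicalZmodType) (psi : topAut K)
  (g : dual R K) : dual R K := dual_comp g (topAutV psi).

Definition hatV (R : realType) (K : topologicalZmodType) (psi : topAut K)
  (g : dual R K) : dual R K := dual_comp g psi.

Lemma hatK (R : realType) (K : topologicalZmodType) (psi : topAut K) :
  cancel (@hat R K psi) (hatV psi).
Proof. by move=> g; apply: dual_eqP => t /=; rewrite topAutK. Qed.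

Lemma hatVK (R : realType) (K : topologicalZmodType) (psi : topAut K) :
  cancel (@hatV R K psi) (hat psi).
Proof. by move=> g; apply: dual_eqP => t /=; rewrite topAutVK. Qed.

Definition unitary_2cocycle (R : realType) (G : zmodType)
    (sigma : G -> G -> R[i]) : Prop :=
  [/\ forall p q, `|sigma p q| = 1,
      forall p, sigma p 0 = 1 /\ sigma 0 p = 1 &
      forall p q r,
        sigma p q * sigma (p + q) r = sigma q r * sigma p (q + r)].

Definition cocycle_pullback (R : realType) (K : topologicalZmodType)
    (psi : topAut K) (sigma : dual R K -> dual R K -> R[i]) :
    dual R K -> dual R K -> R[i] :=
  fun g h => sigma (hatV psi g) (hatV psi h).

Definition star_automorphism (R : realType) (A : starAlgType R)
    (f : A -> A) : Prop :=
  [/\ linear f, bijective f, {morph f : a b / amul a b} &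
      {morph f : a / star a}].

Record action (R : realType) (K : topologicalZmodType) (A : starAlgType R) :=
  Action {
    act :> K -> A -> A;
    act_aut : forall t, star_automorphism (act t);
    actD : forall s t, act (s + t) = act s \o act t
  }.

Section TwistedProduct.
Variables (R : realType) (K : topologicalZmodType) (A : starAlgType R).
Implicit Types (alpha beta : action K A) (g h : dual R K) (a b : A).
Implicit Types (c : dual R K -> A) (sigma : dual R K -> dual R K -> R[i]).

Definition spectral alpha g : set A :=
  [set a | forall t, alpha t a = g t *: a].

Definition spectral_decomposition alpha c a : Prop :=
  [/\ finite_set [set g | c g != 0],
      forall g, spectral alpha g (c g) &
      a = \sum_(g \in [set: dual R K]) c g].

Definition spectral_core alpha : set A :=
  [set a | exists c, spectral_decomposition alpha c a].

Definition spectral_direct alpha : Prop :=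
  forall a c c', spectral_decomposition alpha c a ->
    spectral_decomposition alpha c' a -> c =1 c'.

Definition determined_on_core alpha beta : Prop :=
  forall s t, (forall a, spectral_core alpha a -> alpha s a = beta t a) ->
    forall a, alpha s a = beta t a.

(* The homogeneous components of a when a is in the core (see
   component_unique), and the zero family otherwise. *)
Definition component alpha a : dual R K -> A :=
  xget (fun=> 0) [set c | spectral_decomposition alpha c a].

(* A product on the spectral core: the value is a junk value when a or b is
   outside the core. *)
Definition twisted_product alpha sigma a b : A :=
  \sum_(g \in [set: dual R K]) \sum_(h \in [set: dual R K])
    sigma g h *: amul (component alpha a g) (component alpha b h).

End TwistedProduct.

(* twisted_product is the bilinear extension of
   (a, b) |-> sigma g h *: amul a b for a and b homogeneous of degree g, h. *)
Section TwistedProductTheory.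
Variables (R : realType) (K : topologicalZmodType) (A : starAlgType R).
Variables (alpha : action K A) (sigma : dual R K -> dual R K -> R[i]).
Hypothesis alpha_direct : spectral_direct alpha.
Implicit Types (g h : dual R K) (a b : A) (c : dual R K -> A).

Let amul0 (a : A) : amul a 0 = 0.
Proof. by rewrite -[X in amul a X](scale0r (0 : A)) amulZr scale0r. Qed.

Let a0mul (a : A) : amul 0 a = 0.
Proof. by rewrite -[X in amul X a](scale0r (0 : A)) amulZl scale0r. Qed.

Lemma spectral_linear g z a b :
  spectral alpha g a -> spectral alpha g b -> spectral alpha g (z *: a + b).
Proof.
move=> ag bg t; have [lin _ _ _] := act_aut alpha t.
by rewrite lin ag bg scalerDr !scalerA mulrC.
Qed.

Lemma spectral_mul g h a b :
  spectral alpha g a -> spectral alpha h b -> spectral alpha (g + h) (amul a b).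
Proof.
move=> ag bh t; have [_ _ mul _] := act_aut alpha t.
by rewrite mul ag bh amulZl amulZr scalerA.
Qed.

Lemma component_unique c a :
  spectral_decomposition alpha c a -> component alpha a = c.
Proof.
move=> ca; apply/funext; apply: (alpha_direct _ ca).
by rewrite /component; case: xgetP => [c' _ //|/(_ c)].
Qed.

Lemma componentP a : spectral_core alpha a ->
  spectral_decomposition alpha (component alpha a) a.
Proof. by move=> [c ca]; rewrite (component_unique ca). Qed.

Lemma spectral_decomposition_linear c c' z a b :
  spectral_decomposition alpha c a -> spectral_decomposition alpha c' b ->
  spectral_decomposition alpha (fun g => z *: c g + c' g) (z *: a + b).
Proof.
move=> [cf cs ->] [c'f c's ->].
pose S := fset_set ([set g | c g != 0] `|` [set g | c' g != 0]).
have SP g : g \notin S -> c g = 0 /\ c' g = 0.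
  rewrite in_fset_set ?finite_setU// => gS; split; apply/eqP;
    apply: contraNT gS => cg; apply/mem_set; [by left|by right].
split=> [|g|].
- apply: (@sub_finite_set _ _ [set` S]); last exact: finite_fset.
  move=> g /=; apply: contraNT => /SP[-> ->].
  by rewrite scaler0 addr0.
- exact: spectral_linear.
- rewrite !(@fsbigTE _ _ _ _ S) => [||g /SP[_]|g /SP[]]//.
    by rewrite scaler_sumr -big_split.
  by move=> g /SP[-> ->]; rewrite scaler0 addr0.
Qed.

Lemma spectral_decomposition_homogeneous g a : spectral alpha g a ->
  spectral_decomposition alpha (fun h => if h == g then a else 0) a.
Proof.
move=> ag; split=> [|h|].
- apply: (@sub_finite_set _ _ [set g]) => // h /=.
  by case: (h =P g) => [->|_]; rewrite ?eqxx.
- case: eqP => [->//|_] t; have [lin _ _ _] := act_aut alpha t.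
  by have := lin (-1) 0 0; rewrite !scaleN1r oppr0 addr0 addNr scaler0.
- rewrite (@fsbigTE _ _ _ _ [fset g]%fset) => [|h].
    by rewrite big_seq_fset1 eqxx.
  by rewrite inE => /negbTE->.
Qed.

Lemma spectral_core_linear z a b : spectral_core alpha a ->
  spectral_core alpha b -> spectral_core alpha (z *: a + b).
Proof.
move=> [c ca] [c' cb]; exists (fun g => z *: c g + c' g).
exact: spectral_decomposition_linear.
Qed.

Lemma twisted_product_homogeneous g h a b :
  spectral alpha g a -> spectral alpha h b ->
  twisted_product alpha sigma a b = sigma g h *: amul a b.
Proof.
move=> ag bh; rewrite /twisted_product.
rewrite (component_unique (spectral_decomposition_homogeneous ag)).
rewrite (component_unique (spectral_decomposition_homogeneous bh)).
rewrite (@fsbigTE _ _ _ _ [fset g]%fset) => [|k].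
  rewrite big_seq_fset1 (@fsbigTE _ _ _ _ [fset h]%fset) => [|l].
    by rewrite big_seq_fset1 !eqxx.
  by rewrite inE => /negbTE->; rewrite amul0 scaler0.
rewrite inE => /negbTE->; apply: fsbig1 => l _.
by rewrite a0mul scaler0.
Qed.

Let twisted_productE (S T : {fset dual R K}) a b :
  (forall g, g \notin S -> component alpha a g = 0) ->
  (forall g, g \notin T -> component alpha b g = 0) ->
  twisted_product alpha sigma a b = \sum_(g <- S) \sum_(h <- T)
    sigma g h *: amul (component alpha a g) (component alpha b h).
Proof.
move=> aS bT; rewrite /twisted_product (@fsbigTE _ _ _ _ S) => [|g /aS->].
  apply: eq_bigr => g _; rewrite (@fsbigTE _ _ _ _ T)// => h /bT->.
  by rewrite amul0 scaler0.
by apply: fsbig1 => h _; rewrite a0mul scaler0.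
Qed.

Let core_fset a : spectral_core alpha a ->
  exists S : {fset dual R K}, forall g, g \notin S -> component alpha a g = 0.
Proof.
move=> /componentP[fin _ _]; exists (fset_set [set g | component alpha a g != 0]).
by move=> g; rewrite in_fset_set// => gS; apply/eqP; apply: contraNT gS => cg; exact/mem_set.
Qed.

Lemma twisted_product_linearl z a a' b : spectral_core alpha a ->
  spectral_core alpha a' -> spectral_core alpha b ->
  twisted_product alpha sigma (z *: a + a') b =
  z *: twisted_product alpha sigma a b + twisted_product alpha sigma a' b.
Proof.
move=> ca ca' cb.
have [[S aS] [S' aS'] [T bT]] := And3 (core_fset ca) (core_fset ca') (core_fset cb).
have D := component_unique
  (spectral_decomposition_linear z (componentP ca) (componentP ca')).
have sub g : g \notin (S `|` S')%fset ->
    component alpha a g = 0 /\ component alpha a' g = 0.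
  by rewrite inE negb_or => /andP[/aS-> /aS'->].
rewrite !(@twisted_productE (S `|` S')%fset T) => // [|g /sub[]|g /sub[]|g /sub[e e']]//.
  rewrite scaler_sumr -big_split; apply: eq_bigr => g _ /=.
  rewrite scaler_sumr -big_split; apply: eq_bigr => h _ /=.
  by rewrite D amulDl amulZl scalerDr !scalerA mulrC.
by rewrite D e e' scaler0 addr0.
Qed.

Lemma twisted_product_linearr z a b b' : spectral_core alpha a ->
  spectral_core alpha b -> spectral_core alpha b' ->
  twisted_product alpha sigma a (z *: b + b') =
  z *: twisted_product alpha sigma a b + twisted_product alpha sigma a b'.
Proof.
move=> ca cb cb'.
have [[S aS] [T bT] [T' bT']] := And3 (core_fset ca) (core_fset cb) (core_fset cb').
have D := component_unique
  (spectral_decomposition_linear z (componentP cb) (componentP cb')).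
have sub g : g \notin (T `|` T')%fset ->
    component alpha b g = 0 /\ component alpha b' g = 0.
  by rewrite inE negb_or => /andP[/bT-> /bT'->].
rewrite !(@twisted_productE S (T `|` T')%fset) => // [|g /sub[]|g /sub[]|g /sub[e e']]//.
  rewrite scaler_sumr -big_split; apply: eq_bigr => g _ /=.
  rewrite scaler_sumr -big_split; apply: eq_bigr => h _ /=.
  by rewrite D amulDr amulZr scalerDr !scalerA mulrC.
by rewrite D e e' scaler0 addr0.
Qed.

Lemma twisted_product_core a b : spectral_core alpha a ->
  spectral_core alpha b -> spectral_core alpha (twisted_product alpha sigma a b).
Proof.
move=> ca cb; have [[S aS] [T bT]] := conj (core_fset ca) (core_fset cb).
have core0 : spectral_core alpha 0.
  by have := spectral_core_linear (-1) ca ca; rewrite scaleN1r addNr.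
have coreD x y : spectral_core alpha x -> spectral_core alpha y ->
    spectral_core alpha (x + y).
  by move=> cx cy; rewrite -(scale1r x); exact: spectral_core_linear.
rewrite (twisted_productE aS bT).
apply: big_ind => // g _; apply: big_ind => // h _.
rewrite -[X in spectral_core alpha X]addr0; apply: spectral_core_linear core0.
have [[_ ag _] [_ bh _]] := conj (componentP ca) (componentP cb).
eexists; apply: spectral_decomposition_homogeneous.
exact: spectral_mul (ag g) (bh h).
Qed.

End TwistedProductTheory.

Lemma cocycle_pullback_unitary_2cocycle (R : realType) (K : topologicalZmodType)
    (psi : topAut K) (sigma : dual R K -> dual R K -> R[i]) :
  unitary_2cocycle sigma -> unitary_2cocycle (cocycle_pullback psi sigma).
Proof.
have hatVD : {morph @hatV R K psi : g h / g + h}.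
  by move=> g h; apply: dual_eqP.
have hatV0 : @hatV R K psi 0 = 0 by apply: dual_eqP.
move=> [s1 s0 sC]; split=> [p q|p|p q r]; first exact: s1.
- by rewrite /cocycle_pullback hatV0; exact: s0.
- by rewrite /cocycle_pullback !hatVD; exact: sC.
Qed.

(* Main.v *)
(* If beta = alpha \o psi, then the spectral subspace of beta at g is that of
   alpha at hat psi g, so the two families of homogeneous components differ only
   by the relabelling hat psi of the dual group, and reindexing the twisted
   product along hat psi moves this relabelling onto the cocycle.  If alpha and
   beta have the same spectral subspaces, they have the same components. *)

Require Import Defs.
From mathcomp Require Import all_boot all_order all_algebra.
From mathcomp Require Import all_classical all_reals all_analysis.
From mathcomp.real_closed Require Import complex.

Set Implicit Arguments.
Unset Strict Implicit.
Unset Printing Implicit Defensive.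

Local Open Scope classical_set_scope.
Local Open Scope ring_scope.

Lemma hat_bij (R : realType) (K : topologicalZmodType) (psi : topAut K) :
  bijective (@hat R K psi).
Proof. by exists (hatV psi); [exact: hatK|exact: hatVK]. Qed.

(** On [c (hat psi g)] the operator [beta t = alpha (psi t)] acts by the scalar
    [hat psi g (psi t) = g t]. Relabelling along the bijection [hat psi] keeps the support finite
    and the sum unchanged. *)
Lemma spectral_decomposition_hat (R : realType) (K : topologicalZmodType)
    (A : starAlgType R) (alpha beta : action K A) (psi : topAut K)
    (beta_psi : forall t, beta t = alpha (psi t)) (c : dual R K -> A) (a : A) :
  spectral_decomposition alpha c a ->
  spectral_decomposition beta (c \o hat psi) a.
Proof.
move=> [cfin cspec ->]; split => [|g t|].
- rewrite (_ : [set g | _] = hat psi @^-1` [set g | c g != 0])//.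
  by apply: finite_preimage cfin => g h _ _; exact: (can_inj (@hatK R K psi)).
- by rewrite /= beta_psi cspec /= topAutK.
- by apply: (reindex_fsbigT (hat psi)); exact: hat_bij.
Qed.

(** The previous lemma with the two actions exchanged: [alpha] is the pullback of [beta] along the
    inverse of [psi], whose [hat] is [hatV psi]. *)
Lemma spectral_decomposition_hatV (R : realType) (K : topologicalZmodType)
    (A : starAlgType R) (alpha beta : action K A) (psi : topAut K)
    (beta_psi : forall t, beta t = alpha (psi t)) (c : dual R K -> A) (a : A) :
  spectral_decomposition beta c a ->
  spectral_decomposition alpha (c \o hatV psi) a.
Proof.
have alpha_psi t : alpha t = beta (topAutV psi t) by rewrite beta_psi /= topAutVK.
move=> /(spectral_decomposition_hat alpha_psi).
by rewrite (_ : hat (topAutV psi) = hatV psi)//; apply/funext => g; exact: dual_eqP.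
Qed.

(** Directness is assumed for [alpha] alone; this transfer makes [component_unique] available for
    [beta]. *)
Lemma spectral_direct_pullback (R : realType) (K : topologicalZmodType)
    (A : starAlgType R) (alpha beta : action K A) (psi : topAut K) :
  (forall t, beta t = alpha (psi t)) ->
  spectral_direct alpha -> spectral_direct beta.
Proof.
move=> beta_psi direct a c c' /(spectral_decomposition_hatV beta_psi) ca.
move=> /(spectral_decomposition_hatV beta_psi) c'a g.
(* Evaluating at [hat psi g] undoes the relabelling by [hatV psi]. *)
by have /= := direct _ _ _ ca c'a (hat psi g); rewrite hatK.
Qed.

Theorem corollary11p4 (R : realType) (K : topologicalZmodType)
    (A : starAlgType R) (alpha beta : action K A)
    (sigma : dual R K -> dual R K -> R[i])
    (K_compact : compact [set: K]) (K_hausdorff : hausdorff_space K)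
    (core_eq : spectral_core alpha = spectral_core beta)
    (core_direct : spectral_direct alpha)
    (core_determines : determined_on_core alpha beta)
    (sigma_cocycle : unitary_2cocycle sigma) :
  ((forall g : dual R K, spectral alpha g = spectral beta g) ->
    forall a b, spectral_core alpha a -> spectral_core alpha b ->
      twisted_product alpha sigma a b = twisted_product beta sigma a b)
  /\
  (forall psi : topAut K, (forall t, beta t = alpha (psi t)) ->
    (forall a b, spectral_core alpha a -> spectral_core alpha b ->
      twisted_product beta sigma a b =
      twisted_product alpha (cocycle_pullback psi sigma) a b)
    /\
    (cocycle_pullback psi sigma = sigma ->
      forall a b, spectral_core alpha a -> spectral_core alpha b ->
        twisted_product alpha sigma a b = twisted_product beta sigma a b)).
Proof.
split=> [spectral_eq|psi beta_psi].
  have component_eq a : component alpha a = component beta a.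
    (* Both components are chosen by [xget] with the same default, so equality of the two sets of
       decompositions suffices, for every [a]. *)
    rewrite /component; congr xget; apply/seteqP; split=> c [cfin cspec aE].
      by split=> // g; rewrite -spectral_eq.
    by split=> // g; rewrite spectral_eq.
  by move=> a b _ _; rewrite /twisted_product !component_eq.
have beta_direct := spectral_direct_pullback beta_psi core_direct.
have componentE a : spectral_core alpha a ->
    component beta a = component alpha a \o hat psi.
  move=> /(componentP core_direct)/(spectral_decomposition_hat beta_psi).
  exact: component_unique.
have product_eq a b : spectral_core alpha a -> spectral_core alpha b ->
    twisted_product beta sigma a b =
    twisted_product alpha (cocycle_pullback psi sigma) a b.
  move=> /componentE aE /componentE bE.
  rewrite /twisted_product aE bE.
  (* After both indices are reindexed, the pulled-back cocycle is evaluated at [hat psi g] and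
     [hat psi h], where [hatK] returns [sigma g h]. *)
  rewrite [RHS](reindex_fsbigT (hat psi)); last exact: hat_bij.
  apply: eq_fsbigr => g _.
  rewrite [RHS](reindex_fsbigT (hat psi)); last exact: hat_bij.
  by apply: eq_fsbigr => h _; rewrite /cocycle_pullback !hatK.
by split=> // sigma_psi a b ca cb; rewrite product_eq// sigma_psi.
Qed.
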